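(* Let $\ell\ge 3$ be an integer and let $L(\ell)\ge 0$ be the constant for which $|\mathcal D_{\triangleright,\ell}(n)| = e^{nL(\ell)+o(n)}$ as $n\to\infty$. Then $L(\ell)=\ell\log\ell$.
   Context: For a positive integer $N$, $[N]=\{1,\dots,N\}$. A die with $n$ faces is a vector $D=(D_1,\dots,D_n)$ of real numbers; dice are fair. A die $A$ is better than a die $B$, written $A\triangleright B$, if $\#\{(i,j): A_i>B_j\} > \#\{(i,j): B_j>A_i\}$. $\mathcal D_\ell(n)$ is the set of ordered collections $\mathbf D=(D^{(1)},\dots,D^{(\ell)})$ of $\ell$ dice, each die $D^{(j)}=(D^{(j)}_1,\dots,D^{(j)}_n)$ having $n$ integer faces listed in increasing order $0<D^{(j)}_1<\cdots<D^{(j)}_n$, such that each number in $[\ell n]$ appears exactly once among all the faces of all the dice. $\mathcal D_{\triangleright,\ell}(n)$ is the subset of those $\mathbf D\in\mathcal D_\ell(n)$ with $D^{(1)}\triangleright D^{(2)}\triangleright\cdots\triangleright D^{(\ell)}\triangleright D^{(1)}$. For every $\ell\ge3$ a (necessarily unique) constant $L(\ell)\ge 0$ with $|\mathcal D_{\triangleright,\ell}(n)| = e^{nL(\ell)+o(n)}$ exists, i.e. $L(\ell)=\lim_{n\to\infty}\frac1n\log|\mathcal D_{\triangleright,\ell}(n)|$. *)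

(* Defs.v *)
From HB Require Import structures.
From mathcomp Require Import all_boot all_order all_algebra.
From mathcomp Require Import all_classical all_reals all_analysis.

Set Implicit Arguments.
Unset Strict Implicit.
Unset Printing Implicit Defensive.

Import Order.TTheory GRing.Theory Num.Theory.
Import numFieldNormedType.Exports.

(* Die [A] is better than die [B].  Faces may lie in any totally ordered type,
   in particular in any [realType] or in [nat]. *)
Definition better (d : Order.disp_t) (T : orderType d) (m n : nat)
    (A : 'I_m -> T) (B : 'I_n -> T) : bool :=
  (#|[set p : 'I_m * 'I_n | (A p.1 < B p.2)%O]| <
   #|[set p : 'I_m * 'I_n | (B p.2 < A p.1)%O]|)%N.

Definition is_dice_collection (l n : nat) (D : 'I_l -> 'I_n -> nat) : bool :=
  [&& [forall j, forall i, (0 < D j i)%N],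
      [forall j, forall i1 : 'I_n, forall i2 : 'I_n,
         (i1 < i2)%N ==> (D j i1 < D j i2)%N]
    & all (fun k => #|[set p : 'I_l * 'I_n | D p.1 p.2 == k]| == 1%N)
          (iota 1 (l * n))].

(* Bounding the faces by [l * n], which makes the ambient type finite, loses
   nothing: there are exactly [l * n] faces for the [l * n] required values. *)
Lemma dice_collection_face_le (l n : nat) (D : 'I_l -> 'I_n -> nat) :
  is_dice_collection D -> forall j i, (D j i <= l * n)%N.
Proof.
case/and3P=> /forallP D_gt0 _ /allP once j i.
rewrite leqNgt; apply/negP => big.
pose V (p : 'I_l * 'I_n) := D p.1 p.2.
pose g (k : 'I_(l * n)) : option ('I_l * 'I_n) := [pick p | V p == k.+1].
have gP (k : 'I_(l * n)) : exists2 p, g k = Some p & V p = k.+1.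
  rewrite /g; case: pickP => [p /eqP Vp|no]; first by exists p.
  have /once /eqP : k.+1 \in iota 1 (l * n).
    by rewrite mem_iota /= add1n ltnS; exact: ltn_ord.
  rewrite (_ : [set p | _] = finset.set0) ?cards0 //.
  by apply/finset.setP => p; rewrite !inE; exact: no.
have g_inj : injective g.
  move=> k1 k2; have [p1 -> V1] := gP k1; have [p2 -> V2] := gP k2.
  by case=> p12; apply/val_inj/succn_inj; rewrite -V1 -V2 p12.
have : (#|'I_(l * n)| <= #|[set~ (None : option ('I_l * 'I_n))] :\ Some (j, i)|)%N.
  rewrite -(card_imset _ g_inj); apply/subset_leq_card/fintype.subsetP => _ /imsetP[k _ ->].
  have [p gk Vp] := gP k; rewrite !inE gk /= andbT.
  by apply: contraTneq big => -[pE]; move: Vp; rewrite /V pE /= => ->; rewrite -leqNgt.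
have := cardsD1 (Some (j, i)) [set~ (None : option ('I_l * 'I_n))].
rewrite !inE /= cardsC1 card_option card_prod !card_ord /= add1n => E.
by rewrite [X in (X <= _)%N]E ltnn.
Qed.

Definition dice_collections (l n : nat) :
    {set {ffun 'I_l -> {ffun 'I_n -> 'I_(l * n).+1}}} :=
  [set D : {ffun 'I_l -> {ffun 'I_n -> 'I_(l * n).+1}} |
     is_dice_collection (fun j i => D j i : nat)].

(* [ordS] is the cyclic successor, so the last die has to beat the first. *)
Definition cyclic_dice_collections (l n : nat) :
    {set {ffun 'I_l -> {ffun 'I_n -> 'I_(l * n).+1}}} :=
  [set D in dice_collections l n |
     [forall j : 'I_l, better (fun i => D j i : nat)
                              (fun i => D (ordS j) i : nat)]].

Local Open Scope classical_set_scope.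
Local Open Scope ring_scope.

(* [a n = e^(n L + o(n))].  The equality is only required for large [n], since
   [a n] may vanish for small [n]. *)
Definition exp_growth (R : realType) (a : nat -> R) (L : R) : Prop :=
  exists2 e : nat -> R,
    e =o_\oo (fun n : nat => n%:R : R)
    & \forall n \near \oo, a n = expR (n%:R * L + e n).

(* Main.v *)
Require Import Defs.
From HB Require Import structures.
From mathcomp Require Import all_boot all_order all_algebra.
From mathcomp Require Import all_classical all_reals all_analysis.
From mathcomp Require Import zify ring lra.

(* A collection of dice is a word over ['I_l] (the [k]-th letter names the die
   with face [k]) in which every letter occurs [n] times, so there are at most
   [l ^ (l * n)] of them.  The score of a pair of dice (wins minus losses) is
   additive under concatenation of balanced words and changes sign under
   reversal.  For the lower bound, the score vector takes polynomially many
   values, so some value is shared by all but a polynomial factor of the balanced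
   words; for two such words [u] and [v], all scores of [u ++ rev v] vanish, and
   appending a fixed non-transitive block makes them all positive.  That there
   are [l ^ (l * k)] balanced words, up to a polynomial factor, is again the
   pigeonhole principle: take [l] words of length [k] with the same, most frequent,
   letter counts, and rename the letters of the [j]-th one by the shift [+ j]. *)

Set Implicit Arguments.
Unset Strict Implicit.
Unset Printing Implicit Defensive.

Import Order.TTheory GRing.Theory Num.Theory.
Import numFieldNormedType.Exports.

(** * Pigeonhole and counting by injections *)

Lemma large_fiber (X Y : finType) (A : {set X}) (f : X -> Y) (y0 : Y) :
  exists y, #|A| <= #|Y| * #|[set x in A | f x == y]|.
Proof.
pose m (y : Y) := #|[set x in A | f x == y]|.
case: (@arg_maxnP Y y0 xpredT m) => // y _ ymax; exists y.
rewrite -sum1_card (partition_big f xpredT) //= -sum_nat_const.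
apply: leq_sum => z _; rewrite sum1dep_card; exact: ymax.
Qed.

(** Words are built below by concatenation as plain sequences; this form lets their length be proved
    separately from their construction. *)
Lemma leq_card_tuples (X T : finType) (A : {set X}) (n : nat)
    (g : X -> seq T) (P : pred (seq T)) :
    {in A &, injective g} -> {in A, forall x, size (g x) = n /\ P (g x)} ->
  #|A| <= #|[set t : n.-tuple T | P t]|.
Proof.
move=> g_inj gP.
have [->|[x0 x0A]] := finset.set_0Vmem A; first by rewrite cards0.
have [sz0 _] := gP _ x0A.
pose t0 : n.-tuple T := tcast sz0 (in_tuple (g x0)).
pose h x : n.-tuple T := insubd t0 (g x).
have hE x : x \in A -> tval (h x) = g x.
  by move=> xA; rewrite val_insubd (gP _ xA).1 eqxx.
rewrite -(@card_in_imset _ _ h A); last first.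
  by move=> x y xA yA /(congr1 val) /=; rewrite !hE //; exact: g_inj.
apply/subset_leq_card/fintype.subsetP => _ /imsetP[x xA ->].
by rewrite inE hE //; exact: (gP _ xA).2.
Qed.

(** * Letter positions and ordered pairs of letters in a word *)

Section Words.
Variable T : eqType.
Implicit Types (a b x : T) (w u v : seq T).

(* Positions are counted from [1], as are the faces of the dice. *)
Fixpoint positions a w : seq nat :=
  if w is x :: w' then nseq (x == a) 1 ++ map succn (positions a w') else [::].

(* The number of pairs of positions with [a] at the first and [b] at the second. *)
Fixpoint nprec a b w : nat :=
  if w is x :: w' then (x == a) * count_mem b w' + nprec a b w' else 0.

Lemma size_positions a w : size (positions a w) = count_mem a w.
Proof. by elim: w => //= x w IH; rewrite size_cat size_nseq size_map IH. Qed.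

Lemma positions_gt0 a w k : k \in positions a w -> 0 < k.
Proof.
elim: w => //= x w IH; rewrite mem_cat mem_nseq => /orP[/andP[_ /eqP->]//|].
by case/mapP => i _ ->.
Qed.

Lemma mem_positions x0 a w k :
  (k.+1 \in positions a w) = (k < size w) && (nth x0 w k == a).
Proof.
elim: w k => //= x w IH [|k]; rewrite mem_cat mem_nseq /= lt0b.
  rewrite andbT; case: eqP => //= _; apply/negbTE/mapP => -[i /positions_gt0 i0 [ii]].
  by rewrite -ii in i0.
by rewrite andbF /= (mem_map succn_inj) IH.
Qed.

Lemma positions_le a w k : k \in positions a w -> k <= size w.
Proof.
by case: k => // k; rewrite (mem_positions a) => /andP[].
Qed.

Lemma sorted_positions a w : sorted ltn (positions a w).
Proof.
elim: w => //= x w IH.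
have srt : sorted ltn (map succn (positions a w)) by rewrite sorted_map.
case: (x == a) => //=; rewrite path_min_sorted //.
by apply/allP => _ /mapP[i /positions_gt0 i0 ->] /=.
Qed.

(** This links face comparisons to the recursive count: the first letter sits at position [1],
    before every later position and after none. *)
Lemma sum_positions a b w :
  \sum_(x <- positions a w) \sum_(y <- positions b w) (x < y) = nprec a b w.
Proof.
elim: w => [|z w IH]; first by rewrite /= big_nil.
(* Later positions are shifted by [succn], so [1 < y.+1] is [0 < y], which holds at every
   position. *)
have cnt : \sum_(y <- positions b w) (0 < y) = count_mem b w.
  rewrite -size_positions -sum1_size; apply: eq_big_seq => y /positions_gt0; lia.
have -> : nprec a b (z :: w) = (z == a) * count_mem b w + nprec a b w by [].
rewrite -IH -cnt /= big_cat /=; congr (_ + _); last first.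
  rewrite big_map; apply: eq_bigr => x _; rewrite big_cat big_map /=.
  rewrite (_ : \sum_(i <- nseq _ _) _ = 0) ?add0n //.
  by apply: big1_seq => i /=; rewrite mem_nseq => /andP[_ /eqP->].
case: (z == a); rewrite /= ?big_nil // big_seq1 big_cat big_map /= mul1n.
rewrite (_ : \sum_(i <- nseq _ _) _ = 0) ?add0n //.
by apply: big1_seq => i /=; rewrite mem_nseq => /andP[_ /eqP->].
Qed.

Lemma nprec_cat a b u v :
  nprec a b (u ++ v) = nprec a b u + nprec a b v + count_mem a u * count_mem b v.
Proof. elim: u => [|x u IH] /=; rewrite ?IH ?count_cat; lia. Qed.

Lemma nprec_rev a b w : nprec a b (rev w) = nprec b a w.
Proof.
elim: w => //= x w IH.
by rewrite rev_cons -cats1 nprec_cat IH /= count_rev; lia.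
Qed.

Lemma leq_nprec a b w : nprec a b w <= count_mem a w * count_mem b w.
Proof. by elim: w => //= x w IH; lia. Qed.

Lemma nprec_uniq a b w : uniq w -> a \in w -> b \in w ->
  nprec a b w = (index a w < index b w).
Proof.
have inv0 c d s : c \notin s -> nprec c d s = 0.
  by elim: s => //= z s IH; rewrite inE negb_or => /andP[/negPf + /IH ->]; rewrite eq_sym => ->.
have inv0' c d s : d \notin s -> nprec c d s = 0.
  elim: s => //= z s IH; rewrite inE negb_or => /andP[_ dz].
  by rewrite IH // (count_memPn dz) muln0.
elim: w => //= x w IH /andP[xw uw]; rewrite !inE !(eq_sym x).
case: (eqVneq a x) => [->|ax]; case: (eqVneq b x) => [->|bx] //= aw bw.
- by rewrite (count_memPn xw) inv0.
- by rewrite count_uniq_mem // bw inv0.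
- by rewrite inv0'.
- by rewrite IH.
Qed.

Definition balanced n w := forall a, count_mem a w = n.

End Words.

(** * Upper bound: the number of all collections *)

(** A collection is determined by the map from each value in [[l * n]] to the die carrying it, since
    the increasing order fixes the arrangement of the faces. *)
Lemma card_dice_collections_le (l n : nat) :
  0 < l -> #|dice_collections l n| <= l ^ (l * n).
Proof.
move=> l0.
(* The letter at index [k] names the die with face [k.+1]. In a collection that die exists, so the
   default [Ordinal l0] is never returned. *)
pose h (D : {ffun 'I_l -> {ffun 'I_n -> 'I_(l * n).+1}}) :=
  [ffun k : 'I_(l * n) =>
     odflt (Ordinal l0) [pick j | [exists i, D j i == k.+1 :> nat]]].
have hP D (k : 'I_(l * n)) j : D \in dice_collections l n ->
    (h D k == j) = [exists i, D j i == k.+1 :> nat].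
  rewrite inE => /and3P[_ _ /allP once].
  have /once /eqP/eqP/cards1P[[j0 i0] E] : k.+1 \in iota 1 (l * n).
    by rewrite mem_iota /= add1n ltnS; exact: ltn_ord.
  have DP j' i' : (D j' i' == k.+1 :> nat) = ((j', i') == (j0, i0)).
    by move/finset.setP/(_ (j', i')): E; rewrite !inE.
  rewrite ffunE; case: pickP => [j1 /existsP[i1]|/(_ j0)/existsP[]]; last first.
    by exists i0; rewrite DP.
  rewrite DP => /eqP[-> _] /=; apply/eqP/existsP => [<-|[i]].
    by exists i0; rewrite DP.
  by rewrite DP => /eqP[].
have sub D D' j i : D \in dice_collections l n -> D' \in dice_collections l n ->
    h D = h D' -> exists i', D j i = D' j i'.
  move=> DD DD' hDD'; have := DD; rewrite inE => /and3P[/forallP/(_ j)/forallP/(_ i)].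
  have := ltn_ord (D j i); case E: (D j i : nat) => [//|k] /= kln _ _ _.
  have /existsP[i' /eqP Ei'] : [exists i', D' j i' == k.+1 :> nat].
    rewrite -(hP D' (Ordinal (kln : k < l * n))) // -hDD' hP //.
    by apply/existsP; exists i; rewrite E.
  by exists i'; apply/val_inj; rewrite /= E Ei'.
have srt D j : D \in dice_collections l n ->
    sorted ltn [seq val (D j i) | i <- enum 'I_n].
  rewrite inE => /and3P[_ /forallP/(_ j)/forallP inc _].
  apply: (@homo_sorted _ _ (fun i : 'I_n => val (D j i)) (relpre val ltn)).
    by move=> i1 i2; move/forallP/(_ i2)/implyP: (inc i1); apply.
  by rewrite -sorted_map val_enum_ord iota_ltn_sorted.
have h_inj : {in dice_collections l n &, injective h}.
  move=> D D' DD DD' hDD'; apply/ffunP => j.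
  suff E : [seq val (D j i) | i <- enum 'I_n] = [seq val (D' j i) | i <- enum 'I_n].
    by apply/ffunP => i; apply/val_inj; move/eq_in_map: E; apply; rewrite mem_enum.
  (* Strictly increasing lists with the same members are equal. *)
  apply: (irr_sorted_eq ltn_trans ltnn); [exact: srt|exact: srt|] => k.
  apply/mapP/mapP => -[i _ ->].
    by have [i' ->] := sub _ _ j i DD DD' hDD'; exists i'; rewrite // mem_enum.
  by have [i' ->] := sub _ _ j i DD' DD (esym hDD'); exists i'; rewrite // mem_enum.
by rewrite -(card_in_imset h_inj) (leq_trans (max_card _)) // card_ffun !card_ord.
Qed.

(** * From balanced words to dice *)

Section WordDice.
Variables l n : nat.
Implicit Types (w : seq 'I_l).

Lemma size_balanced w : balanced n w -> size w = l * n.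
Proof.
move=> wP; rewrite -sum1_size (partition_big id xpredT) //=.
under eq_bigr => j _ do rewrite sum1_count wP.
by rewrite sum_nat_const card_ord.
Qed.

Definition dice_of_word w : {ffun 'I_l -> {ffun 'I_n -> 'I_(l * n).+1}} :=
  [ffun j => [ffun i : 'I_n => inord (nth 0 (positions j w) i)]].

Lemma dice_of_wordE w j (i : 'I_n) : balanced n w ->
  dice_of_word w j i = nth 0 (positions j w) i :> nat.
Proof.
move=> wP; rewrite !ffunE inordK // ltnS -(size_balanced wP).
by apply: (@positions_le _ j); rewrite mem_nth // size_positions wP.
Qed.

Lemma dice_of_wordP w : balanced n w -> dice_of_word w \in dice_collections l n.
Proof.
move=> wP; rewrite inE; apply/and3P; split.
- apply/forallP => j; apply/forallP => i; rewrite dice_of_wordE //.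
  by apply: (@positions_gt0 _ j w); rewrite mem_nth // size_positions wP.
- apply/forallP => j; apply/forallP => i1; apply/forallP => i2; apply/implyP => i12.
  rewrite !dice_of_wordE //.
  apply: (sorted_ltn_nth ltn_trans) => //; rewrite ?sorted_positions //;
    by rewrite inE size_positions wP.
apply/allP => k; rewrite mem_iota add1n ltnS => /andP[]; case: k => // k _ kln.
have [x0 _] : exists x0 : 'I_l, true.
  by case: w wP (size_balanced wP) => [_ E|x0 *]; [rewrite -E in kln|exists x0].
pose j := nth x0 w k.
have kj : k.+1 \in positions j w.
  by rewrite (mem_positions x0) (size_balanced wP) kln eqxx.
have ij : index k.+1 (positions j w) < n by rewrite -(wP j) -size_positions index_mem.
apply/cards1P; exists (j, Ordinal ij); apply/finset.setP => -[j' i'].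
rewrite !inE /= dice_of_wordE //; apply/eqP/eqP => [E|[-> ->]]; last first.
  by rewrite /= nth_index.
have i'lt : i' < size (positions j' w) by rewrite size_positions wP.
have : k.+1 \in positions j' w by rewrite -E mem_nth.
rewrite (mem_positions x0) => /andP[_ /eqP jj']; rewrite -/j in jj'; subst j'.
congr (_, _); apply/val_inj; rewrite /= -E index_uniq //.
exact: (sorted_uniq ltn_trans ltnn (sorted_positions _ _)).
Qed.

(** The faces of die [j] are the positions of [j], and the letter at index [k] is the only one
    having [k.+1] among its positions. *)
Lemma dice_of_word_inj w w' : balanced n w -> balanced n w' ->
  dice_of_word w = dice_of_word w' -> w = w'.
Proof.
move=> wP wP' E; have szE : size w = size w' by rewrite !size_balanced.
have posE j : positions j w = positions j w'.
  apply: (@eq_from_nth _ 0); rewrite !size_positions ?wP ?wP' // => i ilt.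
  by rewrite -(dice_of_wordE j (Ordinal ilt) wP) -(dice_of_wordE j (Ordinal ilt) wP') E.
case: w => [|x0 s] in wP E szE posE *; first by case: w' szE {wP' E posE}.
apply: (@eq_from_nth _ x0) => // k klt.
have := mem_positions x0 (nth x0 (x0 :: s) k) (x0 :: s) k.
rewrite eqxx klt posE (mem_positions x0) -szE klt /=.
by move=> /eqP ->.
Qed.

(** Later positions are larger faces, so the wins of [a] over [b] are the pairs with [b] before
    [a]. *)
Lemma better_dice_of_word w a b : balanced n w ->
  better (fun i => dice_of_word w a i : nat) (fun i => dice_of_word w b i : nat)
  = (nprec a b w < nprec b a w).
Proof.
move=> wP.
have ltE c d : #|[set p : 'I_n * 'I_n | (dice_of_word w c p.1 < dice_of_word w d p.2)%O]|
    = nprec c d w.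
  rewrite -sum1_card -sum_positions (big_nth 0) big_mkord size_positions wP.
  under [RHS]eq_bigr => i _ do rewrite (big_nth 0) big_mkord size_positions wP.
  rewrite pair_big /= big_mkcond /=; apply: eq_bigr => p _.
  by rewrite inE -!dice_of_wordE // ltEnat; case: ifP.
rewrite /better ltE -(ltE b a).
congr (_ < _); rewrite -!sum1_card.
rewrite (reindex_inj (h := fun p : 'I_n * 'I_n => (p.2, p.1))) /=; last first.
  by move=> [? ?] [? ?] [-> ->].
by apply: eq_bigl => p; rewrite !inE.
Qed.

Lemma card_cyclic_words (P : pred (seq 'I_l)) :
    (forall w, P w -> balanced n w /\ forall j, nprec j (ordS j) w < nprec (ordS j) j w) ->
  #|[set w : (l * n).-tuple 'I_l | P w]| <= #|cyclic_dice_collections l n|.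
Proof.
move=> PP; rewrite -(@card_in_imset _ _ (fun w : (l * n).-tuple _ => dice_of_word w)).
  apply/subset_leq_card/fintype.subsetP => _ /imsetP[w + ->].
  rewrite inE => /PP[wb wc]; rewrite inE dice_of_wordP //=.
  by apply/forallP => j; rewrite better_dice_of_word.
move=> w w'; rewrite !inE => /PP[wb _] /PP[wb' _] E.
by apply/val_inj/dice_of_word_inj.
Qed.

End WordDice.

(** * Counting balanced words *)

Definition balancedb (l n : nat) (w : seq 'I_l) : bool :=
  [forall a, count_mem a w == n].

Lemma balancedP (l n : nat) (w : seq 'I_l) :
  reflect (balanced n w) (balancedb n w).
Proof. exact: 'forall_eqP. Qed.

Lemma card_balanced_ge (l k : nat) : 0 < l ->
  l ^ (l * k) <= (k.+1 ^ l) ^ l * #|[set w : (l * k).-tuple 'I_l | balancedb k w]|.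
Proof.
(* The successor form gives the letters their addition modulo the number of letters. *)
case: l => // l _.
pose cnt (w : k.-tuple 'I_l.+1) : {ffun 'I_l.+1 -> 'I_k.+1} :=
  [ffun j => inord (count_mem j w)].
have cntE w j : cnt w j = count_mem j w :> nat.
  by rewrite ffunE inordK // ltnS (leq_trans (count_size _ _)) // size_tuple.
have [c] := large_fiber [set: k.-tuple 'I_l.+1] cnt [ffun=> ord0].
set A := [set w in _ | _]; rewrite cardsT card_tuple card_ffun !card_ord => leA.
rewrite [X in _ ^ X <= _]mulnC expnM; rewrite -(@leq_exp2r _ _ l.+1) // in leA.
apply: leq_trans leA _; rewrite expnMn leq_mul2l; apply/orP; right.
pose g (x : {ffun 'I_l.+1 -> k.-tuple 'I_l.+1}) : seq 'I_l.+1 :=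
  flatten [seq map (+%R j) (x j) | j <- enum 'I_l.+1].
rewrite -[X in _ ^ X]card_ord -card_ffun_on -[X in X <= _]cardsE.
have AP w : w \in A -> forall j, count_mem j w = c j.
  by rewrite !inE => /eqP <- j; rewrite cntE.
apply: (@leq_card_tuples _ _ _ _ g) => [x y _ _ gxy|x]; last first.
  rewrite inE => /ffun_onP xA.
  have xb : balancedb k (g x).
    apply/balancedP => a; rewrite /g count_flatten -map_comp sumnE big_map big_enum /=.
    under eq_bigr => j _.
      rewrite count_map (@eq_count _ _ (pred1 (a - j)%R)); last first.
        by move=> i /=; rewrite [RHS]eq_sym subr_eq [RHS]eq_sym addrC.
      rewrite (AP _ (xA j)); over.
    (* The shifted word [j] contains [a] as often as a word of [A] contains [a - j]. Replacing [j]
       by [a - j] sums the counts of all letters in one word, which is its length [k]. *)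
    rewrite (reindex_inj (inv_inj (subKr a))) /=.
    under eq_bigr => j _ do rewrite subKr -(AP _ (xA 0%R)).
    transitivity (size (x 0%R)); last by rewrite size_tuple.
    rewrite -sum1_size [RHS](partition_big id xpredT) //=.
    by apply: eq_bigr => j _; rewrite sum1_count.
  by split=> //; exact: size_balanced (balancedP _ _ xb).
(* All blocks have length [k], so the concatenation can be cut back into blocks and each shift
   undone. *)
have shp z : shape [seq map (+%R j) (z j : k.-tuple 'I_l.+1) | j <- enum 'I_l.+1]
    = [seq k | j <- enum 'I_l.+1].
  by rewrite /shape -map_comp; apply: eq_map => j /=; rewrite size_map size_tuple.
apply/ffunP => j; apply/val_inj.
have /eq_in_map/(_ j) := eq_from_flatten_shape gxy (etrans (shp x) (esym (shp y))).
by move=> /(_ (mem_enum _ _)); exact/inj_map/addrI.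
Qed.

Local Open Scope ring_scope.

(** * The score and its behaviour under concatenation and reversal *)

Section Score.
Variable T : eqType.
Implicit Types (a b : T) (w u v : seq T).

Definition score a b w : int := (nprec b a w)%:Z - (nprec a b w)%:Z.

(** The cross terms of [nprec_cat] both equal [m * n] for balanced words and cancel. *)
Lemma score_cat a b m n u v : balanced m u -> balanced n v ->
  score a b (u ++ v) = score a b u + score a b v.
Proof. by move=> ub vb; rewrite /score !nprec_cat !ub !vb; lia. Qed.

Lemma score_rev a b w : score a b (rev w) = - score a b w.
Proof. by rewrite /score !nprec_rev; lia. Qed.

Lemma balanced_cat m n u v :
  balanced m u -> balanced n v -> balanced (m + n) (u ++ v).
Proof. by move=> ub vb a; rewrite count_cat ub vb. Qed.

Lemma balanced_rev n w : balanced n w -> balanced n (rev w).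
Proof. by move=> wb a; rewrite count_rev. Qed.

Lemma balanced_flatten I (r : seq I) n (F : I -> seq T) :
  (forall i, balanced n (F i)) -> balanced (size r * n) (flatten (map F r)).
Proof.
by move=> Fb; elim: r => //= i r IH; rewrite mulSn; exact: balanced_cat.
Qed.

Lemma score_flatten a b I (r : seq I) n (F : I -> seq T) :
    (forall i, balanced n (F i)) ->
  score a b (flatten (map F r)) = \sum_(i <- r) score a b (F i).
Proof.
move=> Fb; elim: r => /= [|i r IH]; first by rewrite big_nil.
by rewrite big_cons -IH (score_cat _ _ (Fb i) (balanced_flatten r Fb)).
Qed.

End Score.

(** * A fixed non-transitive block *)

Section CyclicBlock.
Variable l' : nat.
Let l := l'.+3.
Implicit Types t j : 'I_l.

(* The decreasing word, rotated: here [j] beats [ordS j] unless [t = j], so each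
   such pair wins in all but one of the [l] rotations. *)
Definition rotated t : seq 'I_l := [seq t - s | s <- enum 'I_l].

Lemma balanced_rotated t : balanced 1 (rotated t).
Proof.
move=> a; rewrite count_uniq_mem; last first.
  by rewrite map_inj_uniq ?enum_uniq //; exact/inv_inj/subKr.
suff -> : a \in rotated t by [].
by apply/mapP; exists (t - a); rewrite ?mem_enum ?subKr.
Qed.

Lemma nprec_rotated t a b : nprec a b (rotated t) = ((t - a)%R < (t - b)%R)%N.
Proof.
have inj : injective (fun s => t - s) by exact/inv_inj/subKr.
have idx c : index c (rotated t) = t - c.
  by rewrite -[in LHS](subKr t c) /rotated (index_map inj) index_enum_ord.
have mem c : c \in rotated t.
  by apply/mapP; exists (t - c); rewrite ?mem_enum ?subKr.
by rewrite nprec_uniq ?idx // /rotated map_inj_uniq ?enum_uniq.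
Qed.

Lemma score_rotated t j :
  score j (ordS j) (rotated t) = if t == j then -1 else 1.
Proof.
have -> : ordS j = j + 1 by apply/val_inj; rewrite /= /Zp_trunc /= addn1.
rewrite /score !nprec_rotated.
(* The letters [j + 1] and [j] stand at indices [e] and [e + 1] modulo [l]; the order is reversed
   only if [e + 1] wraps around to [0]. *)
have E : t - j = (t - (j + 1)) + 1 by ring.
rewrite -subr_eq0 E; move: (t - (j + 1) : 'I_l) => e.
have e1 : (e + 1 : 'I_l) = (e.+1 %% l)%N :> nat by rewrite /= addn1.
have -> : (e + 1 == 0) = ((e + 1 : 'I_l) == 0%N :> nat) by [].
have := ltn_ord e; rewrite e1 leq_eqVlt => /orP[/eqP[eE]|lt].
  by rewrite eE modnn.
by rewrite modn_small // ltnSn ltnNge leqnSn.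
Qed.

Definition cyclic_block := flatten [seq rotated t | t <- enum 'I_l].

Lemma balanced_cyclic_block : balanced l cyclic_block.
Proof.
have := balanced_flatten (enum 'I_l) balanced_rotated.
by rewrite muln1 size_enum_ord.
Qed.

(** Of the [l] rotations, [l - 1] contribute [1] and one contributes [-1]; the total [l - 2] is
    positive because [l] is at least [3]. *)
Lemma score_cyclic_block j : score j (ordS j) cyclic_block = l'.+1.
Proof.
rewrite (score_flatten _ _ _ balanced_rotated) big_enum /= (bigD1 j) //=.
rewrite score_rotated eqxx (eq_bigr (fun=> 1)) => [|t /negPf tj]; last first.
  by rewrite score_rotated tj.
rewrite sumr_const cardC1 card_ord; lia.
Qed.

(* The flag [b] adjusts the parity of the number of faces. *)
Definition padding (b : bool) : seq 'I_l :=
  cyclic_block ++ cyclic_block ++ (if b then rotated 0 else [::]).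

Lemma padding_tail (b : bool) : balanced b (if b then rotated 0 else [::]).
Proof. by case: b => //; exact: balanced_rotated. Qed.

Lemma balanced_padding (b : bool) : balanced (l + (l + b)) (padding b).
Proof.
do 2![apply: balanced_cat; first exact: balanced_cyclic_block].
exact: padding_tail.
Qed.

(** Two blocks are taken because for [l = 3] a single one has score [1], which [rotated 0] may
    cancel. *)
Lemma score_padding_gt0 b j : 0 < score j (ordS j) (padding b).
Proof.
have cb := balanced_cyclic_block.
rewrite (score_cat _ _ cb (balanced_cat cb (@padding_tail b))).
rewrite (score_cat _ _ cb (@padding_tail b)) score_cyclic_block.
by case: b => //; rewrite score_rotated; case: ifP => _; lia.
Qed.

End CyclicBlock.

Local Close Scope ring_scope.

(** * Lower bound: the number of cyclic collections *)

Lemma card_cyclic_ge_balanced (l k : nat) (b : bool) : 2 < l ->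
  #|[set w : (l * k).-tuple 'I_l | balancedb k w]| ^ 2 <=
  (((k ^ 2).+1 ^ 2) ^ l) ^ 2 * #|cyclic_dice_collections l (k + (k + (l + (l + b))))|.
Proof.
case: l => [//|[//|[//|l']]] _; set l := l'.+3; set n := k + _.
(* Both pair counts are recorded instead of their difference: each is at most [k ^ 2], and together
   they fix the score. *)
pose prec (w : (l * k).-tuple 'I_l) : {ffun 'I_l -> 'I_(k ^ 2).+1 * 'I_(k ^ 2).+1} :=
  [ffun j => (inord (nprec j (ordS j) w), inord (nprec (ordS j) j w))].
set B := [set w | _].
have [c] := large_fiber B prec [ffun=> (ord0, ord0)].
rewrite card_ffun card_prod !card_ord mulnn; set A := [set w in B | _] => leA.
rewrite -(@leq_exp2r _ _ 2) // in leA; apply: leq_trans leA _; rewrite expnMn leq_mul2l.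
apply/orP; right.
have Ab u : u \in A -> balanced k u by rewrite !inE => /andP[/balancedP].
have As u v j : u \in A -> v \in A -> score j (ordS j) u = score j (ordS j) v.
  move=> uA vA; have := uA; have := vA; rewrite !inE.
  move=> /andP[_ /eqP<-] /andP[_ /eqP/ffunP/(_ j)]; rewrite !ffunE.
  have lt a a' w : w \in A -> nprec a a' w < (k ^ 2).+1.
    by move=> /Ab wb; rewrite ltnS (leq_trans (leq_nprec _ _ _)) // !wb mulnn.
  case=> /(congr1 val) /= + /(congr1 val) /=; rewrite !inordK ?lt // /score.
  by move=> -> ->.
pose P (w : seq 'I_l) :=
  balancedb n w && [forall j, nprec j (ordS j) w < nprec (ordS j) j w].
apply: leq_trans (card_cyclic_words (P := P) _); last first.
  by move=> w /andP[/balancedP wb /forallP].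
rewrite -mulnn -cardsX.
(* The equal scores of [u] and [v] cancel after the reversal, leaving that of the padding; the known
   lengths of the pieces make [g] injective. *)
pose g (uv : (l * k).-tuple 'I_l * (l * k).-tuple 'I_l) :=
  tval uv.1 ++ (rev uv.2 ++ padding l' b).
apply: (@leq_card_tuples _ _ _ _ g) => [[u v] [u' v'] _ _|[u v]].
  rewrite /g => /eqP; rewrite /= eqseq_cat ?size_tuple // => /andP[/eqP uu'].
  rewrite eqseq_cat ?size_rev ?size_tuple // => /andP[/eqP vv' _].
  by congr (_, _); apply: val_inj => //; rewrite -[LHS]revK vv' revK.
rewrite inE => /andP[/= uA vA].
have pb := balanced_padding b; have vb := balanced_rev (Ab _ vA).
have vpb := balanced_cat vb (pb l').
have gb : balanced n (g (u, v)) by exact: balanced_cat (Ab _ uA) vpb.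
split; first exact: size_balanced gb.
rewrite /P; apply/andP; split; first exact/balancedP.
apply/forallP => j; have := score_padding_gt0 b j.
suff -> : score j (ordS j) (padding l' b) = score j (ordS j) (g (u, v)).
  by rewrite /score subr_gt0 ltz_nat.
rewrite (score_cat _ _ (Ab _ uA) vpb) (score_cat _ _ vb (pb l')) score_rev.
by rewrite (As _ _ j uA vA) addrA subrr add0r.
Qed.

(** With [n = 2 k + 2 l + b], the padding accounts for at most [l * (l + l.+1)] letters. The power
    [2 * l * l] comes from squaring the loss in [card_balanced_ge], and [8 * l] from the fiber of
    pair counts, using that [(k ^ 2).+1] is at most [n.+1 ^ 2]. *)
Lemma card_cyclic_ge (l n : nat) : 2 < l -> l + l <= n ->
  l ^ (l * n) <=
  l ^ (l * (l + l.+1)) * n.+1 ^ (2 * l * l + 8 * l) * #|cyclic_dice_collections l n|.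
Proof.
move=> l2 ln; pose k := (n - (l + l))./2; pose b := odd (n - (l + l)).
have nE : n = k + (k + (l + (l + b))).
  by have := odd_double_half (n - (l + l)); rewrite -/k -/b -addnn; lia.
have kn : k <= n by lia.
have := card_balanced_ge k (ltn_trans (isT : 0 < 2) l2).
have := card_cyclic_ge_balanced k b l2; rewrite -nE.
set m := #|_|; set a := #|_|; set q := ((k ^ 2).+1 ^ 2) ^ l.
move=> m2 lk.
have lk2 : (l ^ (l * k)) ^ 2 <= ((k.+1 ^ l) ^ l) ^ 2 * (q ^ 2 * a).
  rewrite (leq_trans (n := ((k.+1 ^ l) ^ l * m) ^ 2)) ?leq_exp2r //.
  by rewrite expnMn leq_mul2l m2 orbT.
have -> : l * n = l * (l + (l + b)) + l * k * 2 by rewrite {1}nE; lia.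
rewrite expnD [X in _ * X <= _]expnM -mulnA leq_mul //.
  by rewrite leq_pexp2l ?leq_mul2l; lia.
apply: leq_trans lk2 _; rewrite mulnA leq_mul2r expnD; apply/orP; right.
apply: leq_mul.
  by rewrite -!expnM (_ : 2 * l * l = l * (l * 2)) ?leq_exp2r; lia.
rewrite (_ : 8 * l = 2 * (2 * (l * 2))); last lia.
rewrite /q -!expnM [X in _ <= X]expnM leq_exp2r; last lia.
nia.
Qed.

Local Open Scope ring_scope.

(** * Exponential growth rates *)

(** At one large [n] both errors are at most [eps / 2 * n], so the rates differ by at most [eps]. *)
Lemma exp_growth_unique (R : realType) (a : nat -> R) (L L' : R) :
  exp_growth a L -> exp_growth a L' -> L = L'.
Proof.
move=> [e /eqoP eo ea] [e' /eqoP eo' ea'].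
apply/eqP; rewrite -subr_eq0 -normr_eq0 eq_le normr_ge0 andbT.
apply/ler_addgt0Pr => eps eps0; rewrite add0r.
have eps20 : 0 < eps / 2 by rewrite divr_gt0.
have [n [n1 [en [en' [an an']]]]] : exists n : nat, 1 <= n%:R :> R /\
    `|e n| <= eps / 2 * `|n%:R| /\ `|e' n| <= eps / 2 * `|n%:R| /\
    a n = expR (n%:R * L + e n) /\ a n = expR (n%:R * L' + e' n).
  apply: (@filter_ex _ \oo%classic); near=> n; split; first by near: n; exact: nbhs_infty_ger.
  split; first by near: n; exact: eo.
  split; first by near: n; exact: eo'.
  by split; near: n.
have E : n%:R * (L - L') = e' n - e n.
  by have := expR_inj (etrans (esym an) an'); lra.
have n0 : 0 < n%:R :> R by lra.
rewrite -(ler_pM2l n0) -{1}(gtr0_norm n0) -normrM E.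
rewrite (le_trans (ler_normB _ _)) // (le_trans (lerD en' en)) //.
by rewrite (gtr0_norm n0); lra.
Unshelve. all: by end_near. Qed.

(** The error [ln (a n) - n L] lies between [- ln c - E ln (n + 1)] and [0], hence is [o(n)]. *)
Lemma exp_growth_poly (R : realType) (a : nat -> R) (L c : R) (E : nat) :
    1 <= c ->
    (\forall n \near \oo%classic, expR (n%:R * L) <= c * n.+1%:R ^+ E * a n) ->
    (\forall n \near \oo%classic, a n <= expR (n%:R * L)) ->
  exp_growth a L.
Proof.
move=> c1 lo hi; exists (fun n => ln (a n) - n%:R * L); last first.
  near=> n.
  have : expR (n%:R * L) <= c * n.+1%:R ^+ E * a n by near: n.
  move=> h; have a0 : 0 < a n.
    rewrite -(@pmulr_rgt0 _ (c * n.+1%:R ^+ E)); first exact: lt_le_trans (expR_gt0 _) h.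
    by rewrite mulr_gt0 ?exprn_gt0 //; lra.
  by rewrite addrC subrK lnK // posrE.
apply/eqoP => eps eps0; near=> n.
have h : expR (n%:R * L) <= c * n.+1%:R ^+ E * a n by near: n.
have h' : a n <= expR (n%:R * L) by near: n.
have c0 : 0 < c by lra.
have p0 : 0 < n.+1%:R ^+ E :> R by rewrite exprn_gt0.
have a0 : 0 < a n.
  rewrite -(@pmulr_rgt0 _ (c * n.+1%:R ^+ E)); last exact: mulr_gt0.
  exact: lt_le_trans (expR_gt0 _) h.
have /= := h'; rewrite -ler_ln ?posrE ?expR_gt0 // expRK => u.
move: h; rewrite -ler_ln ?posrE ?expR_gt0 ?mulr_gt0 // expRK.
rewrite !lnM ?posrE ?mulr_gt0 // lnXn // => v.
rewrite ler0_norm ?subr_le0 // (ger0_norm (ler0n _ n)) opprB.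
(* This slope makes [E] copies of [d] at most [eps / 2]; [E.+1] keeps the divisor nonzero when
   [E = 0]. *)
pose d := eps / (2 * E.+1%:R).
have d0 : 0 < d by rewrite divr_gt0 // mulr_gt0.
(* [ln y <= d * y - ln d] for every [d > 0], hence [ln y = o(y)] *)
have w : ln n.+1%:R <= d * n.+1%:R - ln d.
  rewrite lerBrDr addrC -lnM ?posrE //; apply/ltW/ln_sublinear/mulr_gt0 => //.
have w' : ln (n.+1%:R : R) *+ E <= (d * n.+1%:R - ln d) *+ E by rewrite lerMn2r w orbT.
have dE : d *+ E <= eps / 2.
  have -> : eps / 2 = d *+ E.+1 by rewrite /d -[RHS]mulr_natr invfM mulrA divfK ?pnatr_eq0.
  by rewrite mulrSr lerDl ltW.
rewrite mulrnBl -mulrnAl in w'.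
have w2 : d *+ E * n.+1%:R <= eps / 2 * n.+1%:R by rewrite ler_wpM2r.
(* From here on the constant terms fit into the other half, [eps / 2 * n]. *)
have : (ln c - ln d *+ E + eps / 2) * (2 / eps) <= n%:R.
  by near: n; exact: nbhs_infty_ger.
rewrite mulrA ler_pdivrMr // => big.
move: w2; rewrite -[n.+1]addn1 natrD; lra.
Unshelve. all: by end_near. Qed.

(** * The growth rate of cyclic collections *)

Lemma exp_growth_cyclic (R : realType) (l : nat) : (2 < l)%N ->
  exp_growth (fun n : nat => #|cyclic_dice_collections l n|%:R : R) (l%:R * ln l%:R).
Proof.
move=> l2; have l0 : (0 < l)%N by lia.
have powE n : expR (n%:R * (l%:R * ln l%:R)) = (l ^ (l * n))%:R :> R.
  by rewrite mulrA -natrM expRM_natl lnK ?posrE ?ltr0n // natrX mulnC.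
apply: (@exp_growth_poly _ _ _ (l ^ (l * (l + l.+1)))%:R (2 * l * l + 8 * l)%N).
- by rewrite ler1n expn_gt0 l0.
- exists (l + l)%N => // n /= ln; rewrite powE -natrX -!natrM ler_nat.
  exact: card_cyclic_ge.
exists 0%N => // n _ /=; rewrite powE ler_nat.
apply: leq_trans (card_dice_collections_le n l0).
by apply/subset_leq_card/fintype.subsetP => D; rewrite inE => /andP[].
Qed.

Theorem theorem3 (R : realType) (l : nat) (hl : (3 <= l)%N) :
  (exists2 L : R, 0 <= L &
     exp_growth (fun n : nat => #|cyclic_dice_collections l n|%:R) L) /\
  (forall L : R, 0 <= L ->
     exp_growth (fun n : nat => #|cyclic_dice_collections l n|%:R) L ->
     L = l%:R * ln (l%:R)).
Proof.
have growth := @exp_growth_cyclic R l hl.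
split=> [|L _ Lgrowth]; last exact: exp_growth_unique Lgrowth growth.
exists (l%:R * ln l%:R) => //.
by rewrite mulr_ge0 // ln_ge0 // ler1n; lia.
Qed.
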